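(* Let $k$ be a fixed positive integer, and let $H$ and $V$ be finite sets of words over the alphabet $\{0,1\}$. For each positive integer $n$, let $b_{H,V,k}(n)$ be the number of $2k \times 2n$ matrices with entries in $\{0,1\}$ such that every row contains exactly $n$ ones and every column contains exactly $k$ ones, every row avoids every pattern in $H$, and every column avoids every pattern in $V$. Then there exist a positive integer $L$ and polynomials $p_0(n), \dots, p_L(n)$ in $n$, with $p_L(n) \neq 0$, such that $$\sum_{i=0}^{L} p_i(n)\, b_{H,V,k}(n+i) = 0$$ for all positive integers $n$.
   Context: A word $w_1 \dots w_n$ contains the word (pattern) $p_1 \dots p_r$ if there is an index $i$ with $w_i = p_1, \dots, w_{i+r-1} = p_r$ (consecutive occurrence); it avoids the pattern otherwise. A row or column of a matrix is read as a word over $\{0,1\}$. *)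

(* Defs.v *)
From mathcomp Require Import all_boot all_order all_algebra finmap.

Set Implicit Arguments.
Unset Strict Implicit.
Unset Printing Implicit Defensive.

(* The letters 0 and 1 are [false] and [true]. *)
Definition word := seq bool.

Definition row_word m n (M : 'M[bool]_(m, n)) (i : 'I_m) : word :=
  [seq M i j | j <- enum 'I_n].

Definition col_word m n (M : 'M[bool]_(m, n)) (j : 'I_n) : word :=
  [seq M i j | i <- enum 'I_m].

Definition avoids_all (P : {fset word}) (w : word) : bool :=
  [forall p : P, ~~ infix (val p) w].

Definition admissible (H V : {fset word}) (k n : nat)
    (M : 'M[bool]_(2 * k, 2 * n)) : bool :=
  [&& [forall i, count_mem true (row_word M i) == n],
      [forall j, count_mem true (col_word M j) == k],
      [forall i, avoids_all H (row_word M i)]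
    & [forall j, avoids_all V (col_word M j)]].

Definition b (H V : {fset word}) (k n : nat) : nat :=
  #|[set M : 'M[bool]_(2 * k, 2 * n) | admissible H V M]|.

(* Main.v *)
Require Import Defs.
From mathcomp Require Import all_boot all_order all_algebra finmap.
From mathcomp Require Import mpoly ring zify.

(* Reading a matrix column by column gives a word over a finite alphabet, and
   by Cayley-Hamilton the generating function G(t, x) of the allowed words, t
   counting columns and x_i the ones in row i, is a rational function with
   denominator B. The number b(n) is the coefficient of t^(2n) (x_0 ... x_(d-1))^n
   in G, d = 2k. As in Lipshitz's theorem on diagonals, among the operators
   (t^2 x_0 ... x_(d-1))^a (t d/dt)^b E_0^(c_0) ... E_(d-1)^(c_(d-1)) with exponents
   at most N, where E_i is a twisted derivative in x_i, there are (N+1)^(d+2), and they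
   map G into a space of dimension O(N^(d+1)): fractions over a common power
   B^m, with m and the degree of the numerator in O(N). So some nontrivial
   combination kills G. Reading it on a suitable coefficient near the diagonal
   makes all but the terms with one fixed c vanish, leaving a recurrence
   for b(n). *)

Set Implicit Arguments.
Unset Strict Implicit.
Unset Printing Implicit Defensive.

Import Order.TTheory GRing.Theory Num.Theory.
Local Open Scope ring_scope.

Lemma exists_linear_relation (F : fieldType) (S T : finType) (f : S -> T -> F) :
  (#|T| < #|S|)%N ->
  exists2 a : S -> F, exists x, a x != 0 & forall y, \sum_x a x * f x y = 0.
Proof.
move=> ltTS; pose A := \matrix_(i < #|S|, j < #|T|) f (enum_val i) (enum_val j).
have: kermx A != 0.
  rewrite -mxrank_eq0 mxrank_ker subn_eq0 -ltnNge.
  exact: leq_ltn_trans (rank_leq_col A) ltTS.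
case/rowV0Pn => v /sub_kermxP vA0 /rV0Pn[j vj].
exists (fun x => v 0 (enum_rank x)).
  by exists (enum_val j); rewrite enum_valK.
move=> y; have /rowP/(_ (enum_rank y)) := vA0; rewrite !mxE => eq0; rewrite -[RHS]eq0.
rewrite (reindex (@enum_val S predT)) /=; last first.
  by exists enum_rank => x _; rewrite ?enum_valK ?enum_rankK.
by apply: eq_bigr => i _; rewrite enum_valK !mxE enum_rankK.
Qed.

(** * Formal Laurent series and powers of a fixed denominator *)

Section FormalSeries.

Variable I : finType.
Implicit Types (e z : {ffun I -> int}) (s t : seq (rat * {ffun I -> int})).
Implicit Types (G : {ffun I -> int} -> rat).

Lemma coordD (z e : {ffun I -> int}) i : (z + e) i = z i + e i :> int.
Proof. by rewrite ffunE. Qed.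

Lemma coordB (z e : {ffun I -> int}) i : (z - e) i = z i - e i :> int.
Proof. by rewrite !ffunE. Qed.

(* A list of pairs (c, e) encodes the Laurent polynomial with terms c x^e, a
   function on exponents encodes a formal series, and [lact] is their product. *)
Definition lact s G z : rat := \sum_(u <- s) u.1 * G (z - u.2).

(** For additive [l], the derivation x^e -> l(e) x^e on Laurent polynomials; [theta] is the same
    derivation on series. *)
Definition lder (l : {ffun I -> int} -> rat) s :=
  [seq (u.1 * l u.2, u.2) | u <- s].

Definition theta (l : {ffun I -> int} -> rat) G z : rat := l z * G z.

Definition supported (D : nat) G :=
  forall z, G z != 0 -> forall i, (`|z i| <= D)%N.

Definition bounded_terms (D : nat) s :=
  forall u, u \in s -> forall i, (`|u.2 i| <= D)%N.

Lemma eq_lact s G G' : G =1 G' -> lact s G =1 lact s G'.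
Proof. by move=> eqG z; apply: eq_bigr => u _; rewrite eqG. Qed.

Lemma eq_iter_lact s G G' m :
  G =1 G' -> iter m (lact s) G =1 iter m (lact s) G'.
Proof. by move=> eqG; elim: m => //= m IHm; apply: eq_lact. Qed.

Lemma lactC s t G : lact s (lact t G) =1 lact t (lact s G).
Proof.
move=> z; rewrite /lact.
under eq_bigr do rewrite mulr_sumr.
under [RHS]eq_bigr do rewrite mulr_sumr.
rewrite exchange_big /=; apply: eq_bigr => u _; apply: eq_bigr => v _.
by rewrite mulrCA; congr (_ * (_ * G _)); rewrite addrAC.
Qed.

Lemma lact_lincomb (T : finType) s (a : T -> rat) (f : T -> _ -> rat) z :
  lact s (fun z => \sum_x a x * f x z) z = \sum_x a x * lact s (f x) z.
Proof.
rewrite /lact; under eq_bigr do rewrite mulr_sumr.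
rewrite exchange_big /=; apply: eq_bigr => x _; rewrite mulr_sumr.
by apply: eq_bigr => u _; rewrite mulrCA.
Qed.

Lemma iter_lact_lincomb (T : finType) s (a : T -> rat) (f : T -> _ -> rat) m z :
  iter m (lact s) (fun z => \sum_x a x * f x z) z
    = \sum_x a x * iter m (lact s) (f x) z.
Proof. by elim: m z => //= m IHm z; rewrite (eq_lact _ IHm) lact_lincomb. Qed.

Lemma lactD s a G a' G' z :
  lact s (fun z => a * G z + a' * G' z) z = a * lact s G z + a' * lact s G' z.
Proof.
rewrite /lact !mulr_sumr -big_split; apply: eq_bigr => u _ /=; ring.
Qed.

Lemma supported_lact D K s G :
  bounded_terms K s -> supported D G -> supported (D + K) (lact s G).
Proof.
move=> sK supG z nz i.
have [/hasP[[c e] us nzu] | /hasPn none] := boolP (has (fun u => G (z - u.2) != 0) s).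
  have := supG _ nzu i; have := sK _ us i; rewrite coordB /=; lia.
case/eqP: nz; apply: big1_seq => u /andP[_ us].
by have := none u us; rewrite negbK => /eqP->; rewrite mulr0.
Qed.

Lemma lact_shift s G e z :
  lact s (fun z => G (z + e)) z = lact s G (z + e).
Proof. by apply: eq_bigr => u _; rewrite addrAC. Qed.

Lemma iter_lact_shift s G e m z :
  iter m (lact s) (fun z => G (z + e)) z = iter m (lact s) G (z + e).
Proof. by elim: m z => //= m IHm z; rewrite (eq_lact _ IHm) lact_shift. Qed.

Section Derivation.

Variable l : {ffun I -> int} -> rat.
Hypothesis lD : {morph l : x y / x + y}.

Lemma lact_theta s G z :
  lact s (theta l G) z = theta l (lact s G) z - lact (lder l s) G z.
Proof.
rewrite /lact /theta big_map mulr_sumr -sumrB; apply: eq_bigr => u _ /=.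
have -> : l z = l (z - u.2) + l u.2 by rewrite -lD subrK.
ring.
Qed.

(** Iterated Leibniz rule. A derivation costs a single power of the denominator: if s^m G is a
    Laurent polynomial, so is s^(m+1) times the derivative of G. *)
Lemma iter_lact_theta s G m z :
  iter m.+1 (lact s) (theta l G) z = theta l (iter m.+1 (lact s) G) z
    - m.+1%:R * lact (lder l s) (iter m (lact s) G) z.
Proof.
elim: m z => [|m IHm] z; first by rewrite /= lact_theta mul1r.
change (lact s (iter m.+1 (lact s) (theta l G)) z = theta l (iter m.+2 (lact s) G) z
    - m.+2%:R * lact (lder l s) (iter m.+1 (lact s) G) z).
have/eq_lact-> : iter m.+1 (lact s) (theta l G) =1
    (fun z => 1 * theta l (iter m.+1 (lact s) G) z
    + (- m.+1%:R) * lact (lder l s) (iter m (lact s) G) z).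
  by move=> y; rewrite IHm mul1r mulNr.
rewrite (lactD s 1 (theta l (iter m.+1 (lact s) G)) _
  (lact (lder l s) (iter m (lact s) G))).
rewrite lact_theta (lactC s (lder l s)) -!iterS -[m.+2]addn1 natrD.
ring.
Qed.

End Derivation.

Section Tame.

Variables (s : seq (rat * {ffun I -> int})) (K : nat).
Hypothesis sK : bounded_terms K s.

(* G is a rational function with denominator s^m and numerator of degree O(m). *)
Definition tame m G := supported ((K + 2) * m) (iter m (lact s) G).

Lemma supported_le D D' G : (D <= D')%N -> supported D G -> supported D' G.
Proof. by move=> leD supG z /supG Gz i; apply: leq_trans (Gz i) leD. Qed.

Lemma tame_le m m' G : (m <= m')%N -> tame m G -> tame m' G.
Proof.
move/subnKC <-; elim: (m' - m)%N => [|j IHj] tG; first by rewrite addn0.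
rewrite addnS; apply: supported_le (supported_lact sK (IHj tG)); lia.
Qed.

(** The shifts to come are division by x_i and multiplication by t^2 x_0 ... x_(d-1); the exponent 2
    of t explains the constant 2 here and in [tame]. *)
Lemma tame_shift m G e :
  (forall i, (`|e i| <= 2)%N) -> tame m G -> tame m.+1 (fun z => G (z + e)).
Proof.
move=> e2 tG z; rewrite iter_lact_shift => nz i.
have := supported_lact sK tG nz i; have := e2 i; rewrite coordD mulnS; lia.
Qed.

Lemma tame_theta m G l :
  {morph l : x y / x + y} -> tame m G -> tame m.+1 (theta l G).
Proof.
move=> lD tG z; rewrite iter_lact_theta // => nz.
have le_m : ((K + 2) * m + K <= (K + 2) * m.+1)%N by lia.
have sK' : bounded_terms K (lder l s).
  by move=> v /mapP[u us ->] i; exact: (sK us i).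
have [z0 | nz1] := eqVneq (iter m.+1 (lact s) G z) 0.
  apply: (supported_le le_m (supported_lact sK' tG) (z := z)).
  by apply/eqP => l0; case/eqP: nz; rewrite /theta z0 l0 !mulr0 subrr.
exact: (supported_le le_m (supported_lact sK tG)).
Qed.

End Tame.
End FormalSeries.

Lemma bounded_terms_le (I : finType) (s : seq (rat * {ffun I -> int})) K K' :
  (K <= K')%N -> bounded_terms K s -> bounded_terms K' s.
Proof. by move=> leK sK u us i; apply: leq_trans (sK u us i) leK. Qed.

Lemma exists_bounded_terms (I : finType) (s : seq (rat * {ffun I -> int})) :
  exists K, bounded_terms K s.
Proof.
elim: s => [|v s [K sK]]; first by exists 0%N.
exists (\max_i `|v.2 i| + K)%N => u; rewrite inE => /predU1P[-> i | us i].
  by apply: leq_trans (leq_addr _ _); apply: (leq_bigmax i).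
by apply: leq_trans (sK u us i) (leq_addl _ _).
Qed.

(** * Differential operators and coefficients near the diagonal *)

Section Diagonal.

Variable d : nat.
Local Notation expo := {ffun option 'I_d -> int}.
Implicit Types (z : expo) (G : expo -> rat) (s : seq (rat * expo)).

(* Monomials in t and x_0, ..., x_(d-1): [None] stands for t. *)
Definition tdeg z : int := z None.
Definition xdeg i z : int := z (Some i).
Definition mkexpo (n : int) (f : 'I_d -> int) : expo :=
  [ffun o => if o is Some i then f i else n].

Lemma tdegD : {morph tdeg : x y / x + y}. Proof. by move=> x y; exact: ffunE. Qed.
Lemma xdegD i : {morph xdeg i : x y / x + y}.
Proof. by move=> x y; exact: ffunE. Qed.
Lemma tdegB : {morph tdeg : x y / x - y}.
Proof. by move=> x y; rewrite /tdeg !ffunE. Qed.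
Lemma xdegB i : {morph xdeg i : x y / x - y}.
Proof. by move=> x y; rewrite /xdeg !ffunE. Qed.
Lemma tdeg_mk n f : tdeg (mkexpo n f) = n. Proof. exact: ffunE. Qed.
Lemma xdeg_mk i n f : xdeg i (mkexpo n f) = f i. Proof. exact: ffunE. Qed.
Definition degE := (tdegB, xdegB, tdegD, xdegD, tdeg_mk, xdeg_mk).

Lemma expoP z z' :
  tdeg z = tdeg z' -> (forall i, xdeg i z = xdeg i z') -> z = z'.
Proof. by move=> eqt eqx; apply/ffunP => -[i|]; [apply: eqx | apply: eqt]. Qed.

Lemma tdeg0 : tdeg 0 = 0. Proof. exact: ffunE. Qed.
Lemma xdeg0 i : xdeg i 0 = 0. Proof. exact: ffunE. Qed.

Lemma tdegMn z m : tdeg (z *+ m) = tdeg z * m%:Z.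
Proof.
elim: m => [|m IHm]; first by rewrite mulr0n tdeg0 mulr0.
rewrite mulrS tdegD IHm; lia.
Qed.

Lemma xdegMn i z m : xdeg i (z *+ m) = xdeg i z * m%:Z.
Proof.
elim: m => [|m IHm]; first by rewrite mulr0n xdeg0 mulr0.
rewrite mulrS xdegD IHm; lia.
Qed.

Definition causal G := forall z, tdeg z < 0 -> G z = 0.

(** Multiplication by 1 plus terms of positive degree in t is injective: by induction on that
    degree, each coefficient of G is determined by earlier ones. *)
Lemma lact_inj s G :
  (forall u, u \in s -> 0 < tdeg u.2) -> causal G ->
  lact ((1, 0) :: s) G =1 (fun=> 0) -> G =1 (fun=> 0).
Proof.
move=> s_gt0 causG sG0.
suff vanish n z : tdeg z < n%:Z -> G z = 0.
  by move=> z; apply: (vanish `|tdeg z|.+1); lia.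
elim: n z => [|n IHn] z zn; first exact: causG.
have := sG0 z; rewrite /lact big_cons /= mul1r subr0 big1_seq ?addr0 // => -[c e].
case/andP=> _ /s_gt0 /= e_gt0; rewrite IHn ?mulr0 // tdegB /=; lia.
Qed.

Lemma causal_lact s G :
  (forall u, u \in s -> 0 <= tdeg u.2) -> causal G -> causal (lact s G).
Proof.
move=> s_ge0 causG z z_lt0; apply: big1_seq => -[c e] /andP[_ /s_ge0 /= e_ge0].
rewrite causG ?mulr0 // tdegB /=; lia.
Qed.

Lemma iter_lact_inj s G m :
  (forall u, u \in s -> 0 < tdeg u.2) -> causal G ->
  iter m (lact ((1, 0) :: s)) G =1 (fun=> 0) -> G =1 (fun=> 0).
Proof.
move=> s_gt0 causG.
have causal_iter j : causal (iter j (lact ((1, 0) :: s)) G).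
  elim: j => //= j; apply: causal_lact => u; rewrite inE => /predU1P[-> | us].
    by rewrite tdeg0.
  exact: ltW (s_gt0 u us).
elim: m => [//|m IHm sG0]; apply: IHm.
exact: lact_inj s_gt0 (causal_iter m) sG0.
Qed.

Definition len_weight z : rat := (tdeg z)%:~R.

Definition row_weight (i : 'I_d) z : rat := (2 * xdeg i z - tdeg z)%:~R.

Definition expo1 i : expo := mkexpo 0 (fun j => ((i == j) : nat)%:Z).

Definition diag (n : int) : expo := mkexpo (2 * n) (fun=> n).

Lemma row_weightD i : {morph row_weight i : x y / x + y}.
Proof. by move=> x y; rewrite /row_weight !degE -intrD; congr _%:~R; ring. Qed.

Lemma len_weightD : {morph len_weight : x y / x + y}.
Proof. by move=> x y; rewrite /len_weight degE intrD. Qed.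

Lemma row_weight_expo1 i j m : row_weight i (expo1 j *+ m) = 2 * (j == i)%:R * m%:R.
Proof.
rewrite /row_weight xdegMn tdegMn !degE mul0r subr0 !intrM mulrA.
by rewrite -!pmulrn.
Qed.

(* Division by x_i followed by 2 x_i d/dx_i - t d/dt, a derivation vanishing on
   the diagonal monomials t^(2n) (x_0 ... x_(d-1))^n. *)
Definition rowop i G z : rat := row_weight i z * G (z + expo1 i).

Definition rowops (c : 'I_d -> nat) r G : expo -> rat :=
  foldr (fun i => iter (c i) (rowop i)) G r.

(** The shift by [diag (-1)] is multiplication by t^2 x_0 ... x_(d-1), and [theta len_weight] is t
    d/dt. *)
Definition monop (a b : nat) (c : 'I_d -> nat) G : expo -> rat :=
  iter a (fun G z => G (z + diag (-1)))
    (iter b (theta len_weight) (rowops c (enum 'I_d) G)).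

Lemma iter_rowop i m G z :
  iter m (rowop i) G z =
    (\prod_(q < m) (row_weight i z + 2 * q%:R)) * G (z + expo1 i *+ m).
Proof.
elim: m z => [|m IHm] z; first by rewrite big_ord0 mul1r mulr0n addr0.
rewrite iterS {1}/rowop IHm big_ord_recl (mulrS (expo1 i)) addrA mulr0 addr0 -mulrA.
congr (_ * (_ * _)); apply: eq_bigr => q _.
rewrite row_weightD -[expo1 i]mulr1n row_weight_expo1 eqxx /= /bump /= add1n -natr1; ring.
Qed.

(** A shift in x_i raises the weight of row i by 2 and leaves the other weights unchanged, so
    operators of distinct rows do not interact. *)
Lemma rowopsE c r G z : uniq r ->
  rowops c r G z = (\prod_(i <- r) \prod_(q < c i) (row_weight i z + 2 * q%:R))
    * G (z + \sum_(i <- r) expo1 i *+ c i).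
Proof.
elim: r z => [|i r IHr] z /=; first by rewrite !big_nil mul1r addr0.
case/andP=> i_r uniq_r; rewrite iter_rowop IHr // !big_cons mulrA addrA.
congr (_ * _ * _); apply: eq_big_seq => j jr; apply: eq_bigr => q _.
have/negPf ji : j != i by apply: contraNneq i_r => <-.
by rewrite row_weightD row_weight_expo1 eq_sym ji mulr0 mul0r addr0.
Qed.

Lemma iter_theta (l : expo -> rat) b G z : iter b (theta l) G z = l z ^+ b * G z.
Proof.
by elim: b => [|b IHb]; rewrite ?mul1r // iterS {1}/theta IHb mulrA -exprS.
Qed.

Lemma diagMn n m : diag n *+ m = diag (n * m%:Z).
Proof. by apply: expoP => [|i]; rewrite ?tdegMn ?xdegMn !degE; lia. Qed.

Lemma iter_diag_shift a G z :
  iter a (fun G z => G (z + diag (-1))) G z = G (z + diag (- a%:Z)).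
Proof.
have -> : diag (- a%:Z) = diag (-1) *+ a by rewrite diagMn mulN1r.
elim: a z => [|a IHa] z; first by rewrite mulr0n addr0.
by rewrite iterS IHa (mulrS (diag _)) addrA.
Qed.

Lemma sum_expo1 (c : 'I_d -> nat) :
  \sum_(i <- enum 'I_d) expo1 i *+ c i = mkexpo 0 (fun i => (c i)%:Z).
Proof.
rewrite big_enum /=; apply: expoP => [|j].
  rewrite (big_morph tdeg tdegD tdeg0) degE big1 // => i _.
  by rewrite tdegMn degE mul0r.
rewrite (big_morph (xdeg j) (xdegD j) (xdeg0 j)) (bigD1 j) //= xdegMn !degE.
rewrite eqxx mul1r big1 ?addr0 // => i /negPf ij.
by rewrite xdegMn degE ij mul0r.
Qed.

Lemma monopE a b c G z (y := z + diag (- a%:Z)) :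
  monop a b c G z = len_weight y ^+ b
    * ((\prod_i \prod_(q < c i) (row_weight i y + 2 * q%:R))
    * G (y + mkexpo 0 (fun i => (c i)%:Z))).
Proof.
rewrite /monop iter_diag_shift iter_theta rowopsE ?enum_uniq // sum_expo1.
by rewrite big_enum.
Qed.

Lemma causal_monop a b c G : causal G -> causal (monop a b c G).
Proof.
move=> causG z z_lt0; rewrite monopE causG ?mulr0 // !degE; lia.
Qed.

(** The exponent that the row operators of orders c shift onto the diagonal. *)
Definition offdiag (n : int) (c : 'I_d -> nat) : expo :=
  mkexpo (2 * n) (fun i => n - (c i)%:Z).

Lemma row_weight_offdiag n c a i :
  row_weight i (offdiag n c + diag (- a%:Z)) = - (2 * (c i)%:R).
Proof.
transitivity ((- (2 * (c i)%:Z))%:~R : rat); last by rewrite intrN intrM.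
rewrite /row_weight !degE; congr _%:~R; lia.
Qed.

(** Row i has weight -2 c0(i) at this point, so the factor with q = c0(i) is zero; it is present
    because c0(i) < c(i). *)
Lemma monop_offdiag_eq0 n c0 a b c G :
  (exists i, c0 i < c i)%N -> monop a b c G (offdiag n c0) = 0.
Proof.
case=> i lt_i; rewrite monopE (bigD1 i) //= (bigD1 (Ordinal lt_i)) //=.
by rewrite row_weight_offdiag addNr !mul0r mulr0.
Qed.

(** The constant left by the row operators at [offdiag n c]: the product of the (-2)^(c i) (c i)!,
    independent of n. *)
Definition rising (c : 'I_d -> nat) : rat :=
  \prod_i \prod_(q < c i) (2 * q%:R - 2 * (c i)%:R).

Lemma rising_neq0 c : rising c != 0.
Proof.
apply/prodf_neq0 => i _; apply/prodf_neq0 => q _.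
rewrite -mulrBr mulf_neq0 // subr_eq0 eqr_nat; have := ltn_ord q; lia.
Qed.

Lemma monop_offdiag n c a b G :
  monop a b c G (offdiag n c)
    = (2 * (n - a%:Z))%:~R ^+ b * (rising c * G (diag (n - a%:Z))).
Proof.
rewrite monopE /len_weight; congr (_ ^+ _ * (_ * G _)).
- by rewrite !degE; congr _%:~R; lia.
- apply: eq_bigr => i _; apply: eq_bigr => q _.
  by rewrite row_weight_offdiag addrC.
- by apply: expoP => [|i]; rewrite !degE; lia.
Qed.

Section TameMonop.

Variables (s : seq (rat * expo)) (K : nat).
Hypothesis sK : bounded_terms K s.

Lemma tame_iter (op : (expo -> rat) -> expo -> rat) q m j G :
  (forall m G, tame s K m G -> tame s K (m + q) (op G)) ->
  tame s K m G -> tame s K (m + j * q) (iter j op G).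
Proof.
move=> op_tame tG; elim: j => [|j IHj]; first by rewrite addn0.
by rewrite mulSn addnCA addnC; apply: op_tame.
Qed.

Lemma tame_rowop m i G : tame s K m G -> tame s K (m + 2) (rowop i G).
Proof.
move=> tG; rewrite addn2; apply: (tame_theta sK (row_weightD i)).
apply: (tame_shift sK) tG => -[j|]; rewrite ffunE //; by case: eqP.
Qed.

(** Each shift and each derivation costs one power of the denominator, and a [rowop] uses one of
    each. The total is linear in the exponents, as the dimension count requires. *)
Lemma tame_monop m a b c G :
  tame s K m G -> tame s K (m + (\sum_i c i * 2) + b + a) (monop a b c G).
Proof.
move=> tG; rewrite -[a in X in tame _ _ X]muln1.
apply: tame_iter => [m' G' tG' | ].
  by rewrite addn1; apply: (tame_shift sK) tG' => -[i|]; rewrite ffunE.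
rewrite -[b in X in tame _ _ X]muln1.
apply: tame_iter => [m' G' tG' | ].
  by rewrite addn1; apply: (tame_theta sK len_weightD) tG'.
rewrite -big_enum /rowops; elim: (enum _) => [|i r IHr] /=.
  by rewrite big_nil addn0.
rewrite big_cons addnCA addnC; apply: tame_iter IHr => m' G'; exact: tame_rowop.
Qed.

End TameMonop.
End Diagonal.

(** * Dimension count and the resulting relation on the diagonal *)

Section DiagonalRelation.

Variable d : nat.
Local Notation expo := {ffun option 'I_d -> int}.

(** Only the (2D+1)^(d+1) exponents in the box, for t and the d variables x_i, impose equations;
    elsewhere every term vanishes. *)
Lemma relation_on_box (T : finType) (g : T -> expo -> rat) (D : nat) :
  ((2 * D).+1 ^ d.+1 < #|T|)%N -> (forall x, supported D (g x)) ->
  exists2 a : T -> rat, exists x, a x != 0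
    & forall z, \sum_x a x * g x z = 0.
Proof.
move=> ltT sup_g.
pose z_of (y : {ffun option 'I_d -> 'I_(2 * D).+1}) : expo :=
  mkexpo ((y None : nat)%:Z - D%:Z) (fun i => (y (Some i) : nat)%:Z - D%:Z).
have [|a a_neq0 a_rel] := @exists_linear_relation _ T _ (fun x y => g x (z_of y)).
  by rewrite card_ffun card_option !card_ord.
exists a => // z.
pose y := [ffun o => inord `|z o + D%:Z|] : {ffun option 'I_d -> 'I_(2 * D).+1}.
have [in_box | /forallPn[o /negP zo]] := boolP [forall o, (`|z o| <= D)%N].
  suff -> : z = z_of y by [].
  apply: expoP => [|i]; rewrite degE ffunE.
    move/forallP/(_ None): in_box; rewrite -/(tdeg z) => zD.
    by rewrite inordK; lia.
  move/forallP/(_ (Some i)): in_box; rewrite -/(xdeg i z) => zD.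
  by rewrite inordK; lia.
apply: big1 => x _; have [-> | /sup_g/(_ o)//] := eqVneq (g x z) 0.
by rewrite mulr0.
Qed.

Variables (s : seq (rat * expo)) (G : expo -> rat) (D0 : nat).
Hypotheses (s_gt0 : forall u, u \in s -> 0 < tdeg u.2) (causG : causal G)
  (supG : supported D0 (lact ((1, 0) :: s) G)).

(* The pair (a, f) stands for the operator [monop a b c], where b = f None and
   c i = f (Some i). *)
Local Notation ops N := ('I_N.+1 * {ffun option 'I_d -> 'I_N.+1})%type.

Definition row_order N (x : ops N) (i : 'I_d) : nat := x.2 (Some i).

Lemma operator_relation :
  exists N (a : ops N -> rat), (exists x, a x != 0) /\
    forall z, \sum_x a x * monop x.1 (x.2 None) (row_order x) G z = 0.
Proof.
have [K0 sK0] := exists_bounded_terms ((1, 0) :: s).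
pose K := (K0 + D0)%N.
have sK := bounded_terms_le (leq_addr D0 K0) sK0; rewrite -/K in sK.
have tG : tame ((1, 0) :: s) K 1 G.
  by apply: supported_le supG; rewrite muln1 /K; lia.
(* With the [m] below, 2(K+2)m + 1 <= q(N+1), and the choice of [N] gives (q(N+1))^(d+1) =
   N(N+1)^(d+1), less than the number (N+1)^(d+2) of operators. *)
pose q := (2 * ((K + 2) * (2 * d + 2)) + 1)%N.
pose N := (q ^ d.+1)%N; exists N.
(* This bounds the total cost 1 + 2dN + N + N, where the 1 comes from G itself. *)
pose m := ((2 * d + 2) * N.+1)%N.
have tame_op (x : ops N) :
    tame ((1, 0) :: s) K m (monop x.1 (x.2 None) (row_order x) G).
  apply: (tame_le sK _ (tame_monop sK tG)).
  have : (\sum_i row_order x i * 2 <= \sum_(i < d) 2 * N)%N.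
    by apply: leq_sum => i _; rewrite mulnC leq_mul2l -ltnS ltn_ord.
  rewrite sum_nat_const card_ord /m.
  have : (x.1 <= N)%N by rewrite -ltnS ltn_ord.
  have : (x.2 None <= N)%N by rewrite -ltnS ltn_ord.
  move: (\sum_i _)%N (nat_of_ord _) (nat_of_ord _) => S a1 b1; nia.
have [|a a_neq0 a_rel] := relation_on_box _ tame_op.
  rewrite card_prod card_ffun card_option !card_ord.
  have le_q : ((2 * ((K + 2) * m)).+1 <= q * N.+1)%N by rewrite /m /q; nia.
  apply: (@leq_ltn_trans ((q * N.+1) ^ d.+1)); first by rewrite leq_exp2r.
  by rewrite expnMn ltn_pmul2r ?expn_gt0 //.
(* The relation holds after multiplication by the m-th power of the denominator, which is cancelled
   here. *)
exists a; split=> //; apply: (iter_lact_inj (m := m) s_gt0).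
  by move=> z z_lt0; apply: big1 => x _; rewrite (causal_monop _ _ _ causG) ?mulr0.
by move=> z; rewrite iter_lact_lincomb.
Qed.

Theorem diagonal_relation :
  exists N (p : 'I_N.+1 -> {poly rat}), (exists a, p a != 0) /\
    forall n : int, \sum_a (p a).[(n - a%:Z)%:~R] * G (diag d (n - a%:Z)) = 0.
Proof.
have [N [coef_of [[x1 x1_neq0] rel]]] := operator_relation.
exists N.
pose wt (x : ops N) := (\sum_i row_order x i)%N.
have [x0 x0_neq0 x0_min] := @arg_minnP _ x1 (fun x => coef_of x != 0) wt x1_neq0.
pose c0 := row_order x0.
pose top (x : ops N) := [forall i, row_order x i == c0 i].
(* Among the operators with nonzero coefficient, x0 has minimal order in the
   rowops. On the coefficient at [offdiag n c0] every other one vanishes, as its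
   order exceeds c0 in some variable. *)
have row_order_gt x : coef_of x != 0 -> ~~ top x -> exists i, (c0 i < row_order x i)%N.
  move=> /x0_min le_wt /forallPn[i0 ne_i0]; apply/existsP.
  apply: contraLR le_wt; rewrite negb_exists => /forallP le_c.
  rewrite -ltnNge /wt (bigD1 i0) //= [ltnRHS](bigD1 i0) //= -/(c0 i0).
  have lt0 : (row_order x i0 < c0 i0)%N by rewrite ltn_neqAle ne_i0 leqNgt le_c.
  rewrite -addSn leq_add // leq_sum // => i _.
  by rewrite leqNgt; apply: le_c.
(* [p a] collects the operators with row orders [c0] and shift a. On the diagonal, t d/dt multiplies
   the coefficient of index j by 2j, whence the power of 2. *)
pose p (a : 'I_N.+1) : {poly rat} := \sum_(f | top (a, f))
  (coef_of (a, f) * 2 ^+ (f None) * rising c0) *: 'X^(f None).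
exists p; split.
  (* With the row orders fixed, f is determined by [f None], so the coefficient of degree
     [x0.2 None] comes from [x0] alone. *)
  exists x0.1; apply/eqP => /(congr1 (fun r : {poly rat} => r`_(x0.2 None))).
  rewrite coef0 coef_sum (bigD1 x0.2) /=; last first.
    by apply/forallP => i; rewrite /row_order.
  rewrite -surjective_pairing coefZ coefXn eqxx mulr1 big1 ?addr0; last first.
    move=> f /andP[/forallP top_f ne_f]; rewrite coefZ coefXn.
    case: eqP => [eqN|]; last by rewrite mulr0.
    case/eqP: ne_f; apply/ffunP => -[i|]; last exact/val_inj/esym/eqN.
    exact/val_inj/eqP/top_f.
  by apply/eqP; rewrite !mulf_neq0 ?rising_neq0 ?expf_neq0.
move=> n; rewrite -[RHS](rel (offdiag n c0)).
rewrite (bigID top) /= [X in _ + X]big1 ?addr0; last first.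
  move=> x ntop; have [-> | /row_order_gt/(_ ntop) lt_i] := eqVneq (coef_of x) 0.
    by rewrite mul0r.
  by rewrite monop_offdiag_eq0 ?mulr0.
transitivity (\sum_a \sum_(f | top (a, f))
    coef_of (a, f) * monop a (f None) (row_order (a, f)) G (offdiag n c0)); last first.
  by rewrite pair_big_dep; apply: eq_big => -[a f].
apply: eq_bigr => a _; rewrite horner_sum mulr_suml.
apply: eq_bigr => f /forallP top_f.
have eq_c i : row_order (a, f) i = c0 i by apply/eqP/top_f.
have -> : offdiag n c0 = offdiag n (row_order (a, f)).
  by apply: expoP => [|i]; rewrite !degE // eq_c.
have -> : rising c0 = rising (row_order (a, f)).
  by apply: eq_bigr => i _; rewrite -eq_c.
rewrite monop_offdiag hornerZ hornerXn intrM exprMn; ring.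
Qed.

End DiagonalRelation.

(** * Transfer matrices and rationality of generating functions of words *)

Lemma sum_tuple_cons (C : finType) (V : nmodType) n (F : seq C -> V) :
  \sum_(w : n.+1.-tuple C) F w = \sum_c \sum_(w : n.-tuple C) F (c :: w).
Proof.
rewrite pair_bigA /= (reindex (fun x : C * n.-tuple C => [tuple of x.1 :: x.2])) //.
exists (fun w : n.+1.-tuple C => (thead w, [tuple of behead w])) => [[c w] _|w _].
  by rewrite /thead tnth0; congr (_, _); apply: val_inj.
by rewrite [RHS]tuple_eta.
Qed.

Lemma sum_tuple_cat (C : finType) (V : nmodType) r n (F : seq C -> V) :
  \sum_(w : (r + n).-tuple C) F w
    = \sum_(u : r.-tuple C) \sum_(w : n.-tuple C) F (u ++ w).
Proof.
elim: r F => [|r IHr] F.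
  by rewrite (big_pred1 [tuple]) // => u; apply/esym/eqP/tuple0.
rewrite (sum_tuple_cons r (fun u => \sum_(w : n.-tuple C) F (u ++ w))).
rewrite [LHS](sum_tuple_cons (r + n) F); apply: eq_bigr => c _.
exact: (IHr (fun v => F (c :: v))).
Qed.

(** In vector form W(n+i) = M^i W(n), so by Cayley-Hamilton the coefficients of the monic
    characteristic polynomial of M serve as [c]. *)
Lemma linear_system_recurrence (R : comNzRingType) (T : finType)
    (A : T -> T -> R) (W : nat -> T -> R) :
  (forall n x, W n.+1 x = \sum_y A x y * W n y) ->
  exists m (c : nat -> R), c m = 1 /\
    forall n x, \sum_(i < m.+1) c i * W (n + i)%N x = 0.
Proof.
move=> recW; have [T0 | [k cardT]] : #|T| = 0%N \/ exists k, #|T| = k.+1.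
  by case: #|T| => [|k]; [left | right; exists k].
  exists 0%N, (fun=> 1); split=> // n x.
  by have := card0_eq T0 x; rewrite inE.
pose g (i : 'I_k.+1) : T := enum_val (cast_ord (esym cardT) i).
pose g' (x : T) : 'I_k.+1 := cast_ord cardT (enum_rank x).
have gK : cancel g g' by move=> i; rewrite /g' enum_valK cast_ordKV.
have g'K : cancel g' g by move=> x; rewrite /g cast_ordK enum_rankK.
pose M := \matrix_(i < k.+1, j < k.+1) A (g i) (g j).
pose w n := \col_(i < k.+1) W n (g i).
have Mw n : M *m w n = w n.+1.
  apply/colP => i; rewrite !mxE recW (reindex g); last by exists g' => ? _.
  by apply: eq_bigr => j _; rewrite !mxE.
have MXw n i : M ^+ i *m w n = w (n + i)%N.
  elim: i => [|i IHi]; first by rewrite mul1mx addn0.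
  by rewrite exprS -mulmxA IHi Mw addnS.
exists k.+1, (fun i => (char_poly M)`_i); split.
  by have /monicP := char_poly_monic M; rewrite lead_coefE size_char_poly.
have CH : \sum_(i < k.+2) (char_poly M)`_i *: M ^+ i = 0.
  rewrite -[RHS](Cayley_Hamilton M) -[in RHS](coefK (char_poly M)) poly_def.
  rewrite size_char_poly rmorph_sum; apply: eq_bigr => i _ /=.
  by rewrite linearZ rmorphXn /= horner_mx_X.
move=> n x; have := congr1 (fun B => (B *m w n) (g' x) 0) CH.
rewrite mul0mx [RHS]mxE => eq0; rewrite -[RHS]eq0 mulmx_suml summxE.
by apply: eq_bigr => i _; rewrite -scalemxAl MXw !mxE g'K.
Qed.

Section WordSums.

Variables (C : finType) (d : nat) (wt : C -> 'X_{1..d}) (adm : pred (seq C)).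

Definition wtw (w : seq C) : 'X_{1..d} := (\sum_(c <- w) wt c)%MM.

Definition word_poly n : {mpoly rat[d]} :=
  \sum_(w : n.-tuple C) (adm w)%:R *: 'X_[wtw w].

(** The states are windows of r letters, and the hypothesis lets admissibility be checked by sliding
    a window along the word. The first r letters only fix the initial state, whence the index r + n
    + i. *)
Lemma word_poly_recurrence r :
  (forall u c w, size u = r ->
    adm (rcons u c ++ w) = adm (rcons u c) && adm (behead (rcons u c) ++ w)) ->
  exists m (c : nat -> {mpoly rat[d]}), c m = 1 /\
    forall n, \sum_(i < m.+1) c i * word_poly (r + n + i) = 0.
Proof.
move=> adm_local.
pose W n (u : r.-tuple C) : {mpoly rat[d]} :=
  \sum_(w : n.-tuple C) (adm (u ++ w))%:R *: 'X_[wtw w].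
pose step (u : r.-tuple C) c : r.-tuple C := [tuple of behead (rcons u c)].
pose A (u v : r.-tuple C) : {mpoly rat[d]} :=
  \sum_(c | step u c == v) (adm (rcons u c))%:R *: 'X_[wt c].
have recW n u : W n.+1 u = \sum_v A u v * W n v.
  rewrite /W (sum_tuple_cons _ (fun w => (adm (u ++ w))%:R *: 'X_[wtw w])).
  rewrite (partition_big (step u) predT) //=; apply: eq_bigr => v _.
  rewrite mulr_suml; apply: eq_bigr => c /eqP <-.
  rewrite mulr_sumr; apply: eq_bigr => w _.
  rewrite -cat_rcons adm_local ?size_tuple // -mulnb natrM.
  by rewrite -scalerAl -scalerAr scalerA /wtw big_cons mpolyXD.
have [m [c [cm1 relW]]] := linear_system_recurrence recW.
exists m, c; split=> // n.
have polyE j : word_poly (r + j) = \sum_(u : r.-tuple C) 'X_[wtw u] * W j u.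
  rewrite /word_poly (sum_tuple_cat _ _ (fun w => (adm w)%:R *: 'X_[wtw w])).
  apply: eq_bigr => u _; rewrite mulr_sumr; apply: eq_bigr => w _.
  by rewrite -scalerAr /wtw big_cat mpolyXD.
under eq_bigr do rewrite -addnA polyE mulr_sumr.
rewrite exchange_big big1 //= => u _.
transitivity ('X_[wtw u] * \sum_(i < m.+1) c i * W (n + i)%N u).
  by rewrite mulr_sumr; apply: eq_bigr => i _; apply: mulrCA.
by rewrite relW mulr0.
Qed.

Hypothesis wt_le1 : forall c i, (wt c i <= 1)%N.

Local Notation expo := {ffun option 'I_d -> int}.

(** The value 0 at negative exponents frees shifts from side conditions. The degree in t is ignored,
    which leaves [j] arbitrary in the lemmas below. *)
Definition xcoef (p : {mpoly rat[d]}) (z : expo) : rat :=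
  if [forall i, 0 <= xdeg i z] then p@_[multinom `|xdeg i z| | i < d] else 0.

Lemma xcoef_sum (J : Type) (r : seq J) P (F : J -> {mpoly rat[d]}) z :
  xcoef (\sum_(j <- r | P j) F j) z = \sum_(j <- r | P j) xcoef (F j) z.
Proof.
rewrite /xcoef; case: ifP => _; first exact: raddf_sum.
by rewrite big1.
Qed.

Lemma xcoefZ a p z : xcoef (a *: p) z = a * xcoef p z.
Proof. by rewrite /xcoef; case: ifP; rewrite ?mcoeffZ ?mulr0. Qed.

Lemma xcoefX m z : xcoef 'X_[m] z = [forall i, xdeg i z == (m i)%:Z]%:R.
Proof.
rewrite /xcoef mcoeffX; case: ifPn => [/forallP z_ge0 | /forallPn[i zi_lt0]].
  congr (nat_of_bool _)%:R; apply/eqP/forallP => [-> i | zm].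
    by rewrite mnmE gez0_abs.
  by apply/mnmP => i; rewrite mnmE (eqP (zm i)).
by case: forallP => // /(_ i)/eqP zi; rewrite zi in zi_lt0.
Qed.

Lemma xcoefXM (j : int) m p z :
  xcoef ('X_[m] * p) z = xcoef p (z - mkexpo j (fun i => (m i)%:Z)).
Proof.
rewrite {1}[p]mpolyE [in RHS](mpolyE p) mulr_sumr !xcoef_sum.
apply: eq_bigr => k _; rewrite -scalerAr !xcoefZ -mpolyXD !xcoefX.
congr (_ * (nat_of_bool _)%:R); apply: eq_forallb => i.
by rewrite mnmDE !degE subr_eq -PoszD addnC.
Qed.

Lemma xcoefM (j : int) q p z :
  xcoef (q * p) z
    = \sum_(m <- msupp q) q@_m * xcoef p (z - mkexpo j (fun i => (m i)%:Z)).
Proof.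
rewrite {1}[q]mpolyE mulr_suml xcoef_sum; apply: eq_bigr => m _.
by rewrite -scalerAl xcoefZ (xcoefXM j).
Qed.

Definition word_series (z : expo) : rat :=
  if 0 <= tdeg z then xcoef (word_poly `|tdeg z|) z else 0.

Lemma wtw_le w i : (wtw w i <= size w)%N.
Proof.
rewrite /wtw mnm_sumE -sum1_size; apply: leq_sum => c _; exact: wt_le1.
Qed.

(** A letter contributes at most one to each x_i, so a bound on the degree in t bounds all
    exponents. *)
Lemma word_series_supp z : word_series z != 0 ->
  0 <= tdeg z /\ forall i, 0 <= xdeg i z <= tdeg z.
Proof.
rewrite /word_series; case: ifP => [t_ge0 | _]; last by rewrite eqxx.
rewrite xcoef_sum => nz; split=> // i.
have [w] : exists w : `|tdeg z|.-tuple C, xcoef 'X_[wtw w] z != 0.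
  apply/existsP; apply: contraNT nz => /existsPn none; rewrite big1 // => w _.
  by have := none w; rewrite negbK xcoefZ => /eqP->; rewrite mulr0.
rewrite xcoefX; case: forallP => [/(_ i)/eqP-> _ | _]; last by rewrite eqxx.
have := wtw_le w i; rewrite size_tuple; lia.
Qed.

Lemma word_series_rational r :
  (forall u c w, size u = r ->
    adm (rcons u c ++ w) = adm (rcons u c) && adm (behead (rcons u c) ++ w)) ->
  exists (s : seq (rat * expo)) D, (forall u, u \in s -> 0 < tdeg u.2) /\
    supported D (lact ((1, 0) :: s) word_series).
Proof.
case/word_poly_recurrence => m [c [cm1 rel]].
(* The denominator is the sum of the c_i t^(m-i), the recurrence read backwards; its constant term
   is c_m = 1. *)
pose e (i : nat) (k : 'X_{1..d}) : expo :=
  mkexpo (m - i)%:Z (fun j => (k j)%:Z).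
pose s := flatten [seq [seq ((c i)@_k, e i k) | k <- msupp (c i)] | i : 'I_m].
have [K sK] := exists_bounded_terms ((1, 0) :: s).
exists s, (r + m + K)%N; split=> [u | z nz].
  case/flattenP => _ /mapP[i _ ->] /mapP[k _ ->]; rewrite degE ltz_nat subn_gt0.
  exact: ltn_ord.
have lactE : lact ((1, 0) :: s) word_series z
    = word_series z + \sum_(i < m) \sum_(k <- msupp (c i))
        (c i)@_k * word_series (z - e i k).
  rewrite /lact big_cons mul1r subr0; congr (_ + _).
  rewrite big_flatten big_map big_enum /=; apply: eq_bigr => i _.
  by rewrite big_map.
(* From degree r + m in t on, the coefficient of the product is an instance of the recurrence for
   [word_poly], hence zero. *)
have t_lt : tdeg z < (r + m)%:Z.
  case: (ltP (tdeg z)) => // t_ge; case/eqP: nz; rewrite lactE.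
  pose n := (`|tdeg z| - (r + m))%N.
  have tE : tdeg z = (r + n + m)%:Z by rewrite /n; lia.
  have seriesE i k : (i <= m)%N -> word_series (z - e i k)
      = xcoef (word_poly (r + n + i)) (z - e i k).
    move=> le_im; have tEi : tdeg (z - e i k) = (r + n + i)%:Z.
      by rewrite !degE tE; lia.
    by rewrite /word_series tEi.
  rewrite -[RHS](_ : xcoef (\sum_(i < m.+1) c i * word_poly (r + n + i)) z = 0).
    rewrite xcoef_sum big_ord_recr /= cm1 mul1r addrC.
    congr (_ + _); first by rewrite /word_series tE.
    apply: eq_bigr => i _.
    rewrite (xcoefM (m - i)%:Z); apply: eq_bigr => k _.
    by rewrite seriesE // ltnW.
  by rewrite rel /xcoef mcoeff0 if_same.
(* A nonzero coefficient at z comes from a nonzero one of the series at z - x, whose exponents are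
   bounded by its degree in t. *)
have [[a x] us nzu] : exists2 u, u \in (1, 0) :: s & word_series (z - u.2) != 0.
  apply/hasP; apply: contraNT nz => /hasPn none; apply/eqP.
  apply: big1_seq => u /andP[_ us]; have := none u us.
  by rewrite negbK => /eqP->; rewrite mulr0.
have := word_series_supp nzu; rewrite /= tdegB => -[t_ge0 x_ge0].
have x_t : 0 <= tdeg x.
  move: us; rewrite inE => /predU1P[[_ ->] | ]; first by rewrite tdeg0.
  by case/flattenP => _ /mapP[i _ ->] /mapP[k _ [_ ->]]; rewrite degE.
move=> [i|].
  have /= := sK _ us (Some i); have := x_ge0 i.
  rewrite -/(xdeg i x) -/(xdeg i z) degE; lia.
rewrite -/(tdeg z); lia.
Qed.

End WordSums.

(** * From backward shifts to a recurrence in forward shifts *)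

Lemma recurrence_of_relation (f : nat -> rat) (N : nat)
    (p : 'I_N.+1 -> {poly rat}) :
  (exists a, p a != 0) ->
  (forall n, (N <= n)%N ->
    \sum_(a < N.+1) (p a).[(n - a)%N%:R] * f (n - a)%N = 0) ->
  exists (L : nat) (q : 'I_L.+1 -> {poly rat}),
    [/\ (0 < L)%N, q ord_max != 0 &
      forall n, \sum_(i < L.+1) (q i).[n%:R] * f (n + i)%N = 0].
Proof.
case=> a1 /(@arg_minnP _ a1 (fun a => p a != 0) (fun a => a : nat)) [].
(* Replacing n by n + N + 1 turns n - a into n + i with i = N + 1 - a, so the least a with [p a]
   nonzero yields the leading index L. *)
move=> a0 p0 a0_min rel; pose L := (N.+1 - a0)%N.
have a0_le : (a0 <= N)%N by rewrite -ltnS ltn_ord.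
(* The zero coefficient at i = 0 is padding: it keeps L positive even when only the last [p a] is
   nonzero. *)
pose r i : {poly rat} := if i is j.+1 then p (inord (N - j)) else 0.
exists L, (fun i => r i \Po ('X + (i : nat)%:R%:P)); split.
- by rewrite subn_gt0 ltn_ord.
- have -> : (ord_max : 'I_L.+1) = L :> nat by [].
  rewrite /L subSn // /r subKn // inord_val.
  by rewrite -size_poly_eq0 size_comp_poly2 ?size_XaddC // size_poly_eq0.
move=> n; pose F i := (r i.+1).[(n + i.+1)%N%:R] * f (n + i.+1)%N.
transitivity (\sum_(i < L) F i).
  rewrite big_ord_recl /= comp_poly0 horner0 mul0r add0r.
  apply: eq_bigr => i _; rewrite horner_comp !hornerE /F /bump /= add1n.
  by rewrite -natrD -addnA add1n.
transitivity (\sum_(i < N.+1) F i).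
  have leL : (L <= N.+1)%N by rewrite leq_subr.
  rewrite (big_ord_widen _ _ leL) [RHS](bigID (fun i : 'I__ => (i < L)%N)) /=.
  rewrite [X in _ = _ + X]big1 ?addr0 // => i; rewrite -leqNgt => le_i.
  have [p_eq0 | /a0_min /=] := eqVneq (p (inord (N - i))) 0.
    by rewrite /F /= p_eq0 horner0 mul0r.
  rewrite inordK; last by rewrite ltnS leq_subr.
  by have := ltn_ord i; rewrite /L in le_i *; lia.
rewrite (reindex_inj rev_ord_inj) /= -[RHS](rel (n + N.+1)%N); last by lia.
apply: eq_bigr => a _; rewrite /F /=.
have a_le : (a <= N)%N by rewrite -ltnS ltn_ord.
have -> : (N - (N.+1 - a.+1) = a)%N by lia.
have -> : (n + (N.+1 - a.+1).+1 = n + N.+1 - a)%N by lia.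
by rewrite inord_val.
Qed.

(** * Pattern avoidance, and matrices as words of columns *)

Lemma avoids_allP (P : {fset word}) (w : word) :
  reflect (forall p, p \in P -> ~~ infix p w) (avoids_all P w).
Proof.
apply: (iffP forallP) => [av p pP | av p]; first exact: (av [` pP]%fset).
exact/av/valP.
Qed.

(** An occurrence starting at x is too short to leave x v; any other occurrence lies in v w. *)
Lemma avoids_all_local (P : {fset word}) x v w :
  (forall p, p \in P -> (size p <= (size v).+1)%N) ->
  avoids_all P (x :: v ++ w) = avoids_all P (x :: v) && avoids_all P (v ++ w).
Proof.
move=> szP; have infix_split p : p \in P ->
    infix p (x :: v ++ w) = infix p (x :: v) || infix p (v ++ w).
  move=> /szP sz_p; rewrite !infix_consl -orbA; congr (_ || _).
    by rewrite !prefixE -cat_cons takel_cat.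
  by apply/idP/orP => [|[/infix_catr->|]] //; right.
apply/avoids_allP/andP => [av | [/avoids_allP av1 /avoids_allP av2] p pP].
  by split; apply/avoids_allP => p pP; have := av p pP;
    rewrite infix_split // negb_or => /andP[].
by rewrite infix_split // negb_or av1 ?av2.
Qed.

Section Matrices.

Variables (H V : {fset word}) (k : nat).
Local Notation d := (2 * k)%N.

Definition col_letters (c : 'cV[bool]_d) : word := [seq c i 0 | i <- enum 'I_d].

Definition row_letters i (w : seq 'cV[bool]_d) : word :=
  [seq (c : 'cV[bool]_d) i 0 | c <- w].

Definition col_ok (c : 'cV[bool]_d) : bool :=
  (count_mem true (col_letters c) == k) && avoids_all V (col_letters c).

Definition word_adm : pred (seq 'cV[bool]_d) :=
  fun w => all col_ok w && [forall i, avoids_all H (row_letters i w)].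

Definition col_wt (c : 'cV[bool]_d) : 'X_{1..d} := [multinom (c i 0%R : nat) | i < d].

(** The window length, the total length of the patterns in [H], is a crude bound on each of them;
    the column conditions concern single letters. *)
Lemma word_adm_local u c w :
  size u = (\sum_(p <- H) size p)%N ->
  word_adm (rcons u c ++ w)
    = word_adm (rcons u c) && word_adm (behead (rcons u c) ++ w).
Proof.
move=> sz_u; case: (rcons u c) (size_rcons u c) => // x v /= [sz_v].
have row_local i : avoids_all H (row_letters i (x :: v ++ w)) =
    avoids_all H (row_letters i (x :: v)) && avoids_all H (row_letters i (v ++ w)).
  rewrite /row_letters /= !map_cat; apply: avoids_all_local => p pH.
  by rewrite size_map sz_v sz_u leqW // (big_rem p) //= leq_addr.
rewrite /word_adm /= all_cat.
have -> : [forall i, avoids_all H (row_letters i (x :: v ++ w))] =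
    [forall i, avoids_all H (row_letters i (x :: v))]
    && [forall i, avoids_all H (row_letters i (v ++ w))].
  apply/forallP/andP => [av | [/forallP av1 /forallP av2] i].
    by split; apply/forallP => i; have := av i; rewrite row_local => /andP[].
  by rewrite row_local av1 av2.
rewrite -!andbA; do !case: (all _ _); rewrite ?andbF //=.
Qed.

Lemma wtw_count w i : wtw col_wt w i = count_mem true (row_letters i w).
Proof.
rewrite /wtw mnm_sumE; elim: w => [|c w IHw]; first by rewrite big_nil.
by rewrite big_cons IHw mnmE /=; case: (c i 0).
Qed.

Lemma admissibleE n (M : 'M[bool]_(d, 2 * n)) (w := [tuple col j M | j < 2 * n]) :
  admissible H V M = word_adm w && (wtw col_wt w == [multinom n | i < d]).
Proof.
have colE j : col_word M j = col_letters (col j M).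
  by apply: eq_map => i; rewrite mxE.
have rowE i : row_word M i = row_letters i w.
  rewrite /row_letters /w /= -map_comp.
  by apply: eq_map => j; rewrite /= mxE.
have -> : (wtw col_wt w == [multinom n | i < d]) =
    [forall i, count_mem true (row_word M i) == n].
  apply/eqP/forallP => [/mnmP eq_w i | eq_w].
    by rewrite rowE -wtw_count eq_w mnmE.
  by apply/mnmP => i; rewrite wtw_count -rowE mnmE; apply/eqP.
have -> : word_adm w =
    [&& [forall j, count_mem true (col_word M j) == k],
        [forall i, avoids_all H (row_word M i)]
      & [forall j, avoids_all V (col_word M j)]].
  rewrite /word_adm (eq_forallb (fun i => congr1 (avoids_all H) (esym (rowE i)))).
  rewrite [in RHS]andbCA andbC; congr (_ && _).
  apply/allP/andP => [ok | [/forallP ok1 /forallP ok2] c].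
    have ok_j j : col_ok (col j M).
      by apply/ok/mapP; exists j; rewrite ?mem_enum.
    by split; apply/forallP => j; have /andP[] := ok_j j; rewrite colE.
  rewrite /w /= => /mapP[j _ ->].
  by rewrite /col_ok -colE ok1 ok2.
by rewrite andbC.
Qed.

Lemma word_series_diag n : word_series col_wt word_adm (diag d n%:Z) = (b H V k n)%:R.
Proof.
have absE : `|(2 * n%:Z)%R|%N = (2 * n)%N by lia.
rewrite /word_series degE absE /= xcoef_sum.
rewrite /b -sum1dep_card natr_sum [RHS]big_mkcond.
rewrite (reindex (fun M : 'M[bool]_(d, 2 * n) => [tuple col j M | j < 2 * n])) /=.
  apply: eq_bigr => M _; rewrite admissibleE xcoefZ xcoefX.
  set w := [tuple _ | _ < _].
  have -> : [forall i, xdeg i (diag d n%:Z) == (wtw col_wt w i)%:Z]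
      = (wtw col_wt w == [multinom n | i < d]).
    apply/forallP/eqP => [eq_w | -> i]; last by rewrite degE mnmE.
    by apply/mnmP => i; have := eq_w i; rewrite degE mnmE => /eqP[].
  by rewrite -natrM mulnb; case: (_ && _).
exists (fun w : (2 * n).-tuple 'cV[bool]_d => \matrix_(i, j) tnth w j i 0).
  by move=> M _; apply/matrixP => i j; rewrite mxE tnth_mktuple mxE.
move=> w _; apply: eq_from_tnth => j; rewrite tnth_mktuple.
by apply/colP => i; rewrite !mxE.
Qed.

End Matrices.

Theorem theorem3 (k : nat) (k_gt0 : (0 < k)%N) (H V : {fset word}) :
  exists (L : nat) (p : 'I_L.+1 -> {poly rat}),
    [/\ (0 < L)%N,
        p ord_max != 0
      & forall n : nat, (0 < n)%N ->
          \sum_(i < L.+1) (p i).[n%:R] * (b H V k (n + i))%:R = 0].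
Proof.
have wt_le1 c i : (@col_wt k c i <= 1)%N by rewrite mnmE; case: (c i 0).
have [s [D [s_gt0 supp]]] := word_series_rational wt_le1 (@word_adm_local H V k).
have caus : causal (word_series (@col_wt k) (@word_adm H V k)).
  by move=> z; rewrite /word_series ltNge => /negbTE->.
have [N [p [p_neq0 rel]]] := diagonal_relation s_gt0 caus supp.
have [|L [q [L_gt0 q_neq0 rec]]] :=
  recurrence_of_relation (f := fun n => (b H V k n)%:R) p_neq0 _.
  (* The diagonal relation is over the integers; for n >= N every n - a is a natural number, so the
     coefficients are values of [b]. *)
  move=> n le_Nn; rewrite -[RHS](rel n%:Z); apply: eq_bigr => a _.
  have le_an : (a <= n)%N by apply: leq_trans le_Nn; rewrite -ltnS ltn_ord.
  by rewrite subzn // word_series_diag.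
by exists L, q; split=> // n _; apply: rec.
Qed.
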